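(* Let $K$ be a field and $S=K[x_1,\ldots,x_n]$. Let $I\subset S$ be a monomial complete intersection ideal, and let $m$ be the number of its minimal monomial generators. Then \[ 1 + n - m \leq \operatorname{sdepth}(I) \leq \left\lceil \frac{m}{2} \right\rceil + n - m.\] In particular, $I$ satisfies Stanley's conjecture, that is, $\operatorname{sdepth}(I)\geq \operatorname{depth}(I)$.
   Context: Let $I$ be a nonzero monomial ideal of a polynomial ring $S=K[x_1,\ldots,x_n]$ over a field $K$. For a monomial $u\in S$ and a subset $Z\subset\{x_1,\ldots,x_n\}$, $uK[Z]$ denotes the $K$-subspace of $S$ spanned by all monomials $uw$ with $w$ a monomial in the variables of $Z$. A Stanley decomposition of $I$ is a finite direct sum decomposition of $K$-vector spaces $\mathcal D: I=\bigoplus_{i=1}^r u_iK[Z_i]$ with $u_i\in S$ monomials and $Z_i\subset\{x_1,\ldots,x_n\}$. Put $\operatorname{sdepth}(\mathcal D)=\min_{1\le i\le r}|Z_i|$. The Stanley depth of $I$ is $\operatorname{sdepth}(I)=\max\{\operatorname{sdepth}(\mathcal D) : \mathcal D \text{ is a Stanley decomposition of } I\}$. A monomial complete intersection ideal is a nonzero proper monomial ideal $I\subset S$ whose minimal monomial generators $v_1,\ldots,v_m$ form a regular sequence in $S$ (equivalently, they are monomials different from $1$ with pairwise disjoint supports, the support of a monomial being the set of variables dividing it). $\operatorname{depth}(I)$ is the depth of $I$ as an $S$-module with respect to the maximal ideal $(x_1,\ldots,x_n)$. *)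

(* Defs.v *)
From HB Require Import structures.
From mathcomp Require Import all_boot all_order all_algebra.
From mathcomp Require Import mpoly.

Set Implicit Arguments.
Unset Strict Implicit.
Unset Printing Implicit Defensive.

Import GRing.Theory.
Local Open Scope ring_scope.

Definition is_max (P : nat -> Prop) (d : nat) : Prop :=
  P d /\ forall e, P e -> (e <= d)%N.

(** * Regular sequences and depth

    Modules are ideals of [R], given as predicates; [R] itself is [predT]. *)

(* [f_1 M + ... + f_k M], as a subset of [R]. *)
Definition mul_ideal (R : comNzRingType) (fs : seq R) (M : {pred R}) (p : R)
    : Prop :=
  exists g : 'I_(size fs) -> R,
    (forall i, g i \in M) /\ p = \sum_(i < size fs) fs`_i * g i.

(* [fs] is regular on [M]: [f_k] is a nonzerodivisor on
   [M / (f_1, ..., f_(k-1)) M] for all [k], and [M <> (f_1, ..., f_r) M]. *)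
Definition regular_sequence (R : comNzRingType) (M : {pred R}) (fs : seq R)
    : Prop :=
  (forall k, (k < size fs)%N -> forall p, p \in M ->
     mul_ideal (take k fs) M (fs`_k * p) -> mul_ideal (take k fs) M p)
  /\ (exists2 p, p \in M & ~ mul_ideal fs M p).

Section MonomialIdeals.
Variables (K : fieldType) (n : nat).
Local Notation S := {mpoly K[n]}.

Definition irrelevant_ideal (p : S) : Prop :=
  mul_ideal [seq 'X_i | i <- enum 'I_n] predT p.

Definition is_depth (M : {pred S}) : nat -> Prop :=
  is_max (fun d => exists fs : seq S,
    [/\ size fs = d, {in fs, forall f, irrelevant_ideal f}
      & regular_sequence M fs]).

(** * Monomial ideals *)

Definition monomials (v : seq 'X_{1..n}) : seq S := [seq 'X_[u] | u <- v].

Definition generated_by (I : {pred S}) (v : seq 'X_{1..n}) : Prop :=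
  forall p, p \in I <-> mul_ideal (monomials v) predT p.

(* Irredundancy also rules out repetitions in [v]. *)
Definition minimal_generators (I : {pred S}) (v : seq 'X_{1..n}) : Prop :=
  generated_by I v /\ {in v, forall u, ~ generated_by I (rem u v)}.

Definition monomial_complete_intersection (I : {pred S}) (v : seq 'X_{1..n})
    : Prop :=
  [/\ exists2 p, p \in I & p != 0,
      1 \notin I,
      minimal_generators I v
    & regular_sequence predT (monomials v)].

(** * Stanley decompositions *)

(* [u K[Z]]: a polynomial lies in the span of the monomials [u w], with [w] a
   monomial in the variables of [Z], iff its support consists of such. *)
Definition stanley_space (u : 'X_{1..n}) (Z : {set 'I_n}) (p : S) : Prop :=
  forall m, m \in msupp p ->
    exists2 w : 'X_{1..n}, (forall i, i \notin Z -> w i = 0%N) & m = (u + w)%MM.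

(* [I] is the internal direct sum of the spaces [u_i K[Z_i]], where
   [D i = (u_i, Z_i)]. *)
Definition stanley_decomposition (I : {pred S}) (r : nat)
    (D : 'I_r -> 'X_{1..n} * {set 'I_n}) : Prop :=
  (forall i p, stanley_space (D i).1 (D i).2 p -> p \in I) /\
  (forall p, p \in I -> exists! f : {ffun 'I_r -> S},
     (forall i, stanley_space (D i).1 (D i).2 (f i)) /\ p = \sum_(i < r) f i).

(* The default value [n] bounds every [#|Z_i|], so for [r > 0] this is the
   minimum of the [#|Z_i|]; a nonzero [I] has no decomposition with [r = 0]. *)
Definition decomposition_sdepth (r : nat)
    (D : 'I_r -> 'X_{1..n} * {set 'I_n}) : nat :=
  \big[minn/n]_(i < r) #|(D i).2|.

Definition is_sdepth (I : {pred S}) : nat -> Prop :=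
  is_max (fun d => exists (r : nat) (D : 'I_r -> 'X_{1..n} * {set 'I_n}),
    stanley_decomposition I D /\ decomposition_sdepth D = d).

End MonomialIdeals.

(* Main.v *)
Require Import Defs.
From HB Require Import structures.
From Stdlib Require Import Classical.
From mathcomp Require Import all_boot all_order all_algebra.
From mathcomp Require Import mpoly.
From mathcomp Require Import zify.

(* The generators [v_1, ..., v_m] have pairwise disjoint supports. Removing the
   multiples of [v_(k+1)] from a Stanley decomposition of the ideal generated by
   [v_1, ..., v_k] cuts each Stanley space into spaces with one variable less,
   which gives [1 + n - m <= sdepth I]. For the upper bound, in a Stanley
   decomposition [v_k] can only lie in a space [v_k K[Z_k]]. The relation
   [supp v_l \subset Z_k] for [k != l] is antisymmetric because [v_k v_l] lies
   in a single space, and each [k] is related to all but at most [n - #|Z_k|] of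
   the other [l]; counting related pairs bounds the minimum of the [#|Z_k|].
   Finally [depth I <= 1 + n - m]: an [I]-regular sequence of length [d] kills
   the Koszul homology of [I] in degrees above [n - d], but the homology in
   degree [m - 1] is not zero. *)

Set Implicit Arguments.
Unset Strict Implicit.
Unset Printing Implicit Defensive.

Import GRing.Theory.
Local Open Scope ring_scope.

(** * Ideals as predicates, and ideals generated by a sequence *)

Section Ideals.
Variable R : comNzRingType.
Implicit Types (fs : seq R) (M : {pred R}) (P : R -> Prop).

Definition is_ideal P : Prop :=
  [/\ P 0, forall x y, P x -> P y -> P (x + y) & forall r x, P x -> P (r * x)].

(** Coefficients indexed by [nat] carry over unchanged when the sequence grows. *)
Lemma mul_idealP fs M p :
  mul_ideal fs M p <-> exists g : nat -> R,
    (forall i, (i < size fs)%N -> g i \in M) /\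
    p = \sum_(i < size fs) fs`_i * g i.
Proof.
split=> [[g [gM ->]] | [g [gM ->]]]; last first.
  by exists (fun i => g i); split=> // i; apply: gM.
exists (fun i => oapp g 0 (insub i)); split=> [i lti | ].
  by rewrite insubT /=.
by apply: eq_bigr => i _; rewrite valK.
Qed.

Lemma mul_ideal_nil M p : mul_ideal [::] M p <-> p = 0.
Proof.
split=> [[g [_ ->]] | ->]; first by rewrite big_ord0.
by exists (fun=> 0); split=> [[]|]; rewrite ?big_ord0.
Qed.

Lemma mul_ideal_rcons fs f M p :
  mul_ideal (rcons fs f) M p <->
  exists q a, [/\ mul_ideal fs M q, a \in M & p = q + f * a].
Proof.
split=> [/mul_idealP [g [gM ->]] | [q [a [/mul_idealP [g [gM ->]] aM ->]]]].
  exists (\sum_(i < size fs) fs`_i * g i), (g (size fs)); split.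
  - by apply/mul_idealP; exists g; split=> // i lti; apply: gM;
      rewrite size_rcons ltnW.
  - by apply: gM; rewrite size_rcons.
  rewrite size_rcons big_ord_recr /= nth_rcons ltnn eqxx; congr (_ + _).
  by apply: eq_bigr => i _; rewrite nth_rcons ltn_ord.
apply/mul_idealP; exists (fun i => if (i < size fs)%N then g i else a).
split=> [i _ | ]; first by case: ifP => // /gM.
rewrite size_rcons big_ord_recr /= nth_rcons !ltnn eqxx; congr (_ + _).
by apply: eq_bigr => i _; rewrite nth_rcons ltn_ord.
Qed.

Lemma mul_ideal_is_ideal fs M :
  is_ideal (fun x => x \in M) -> is_ideal (mul_ideal fs M).
Proof.
move=> [M0 MD MM]; split.
- apply/mul_idealP; exists (fun=> 0); split=> //.
  by rewrite big1 // => i _; rewrite mulr0.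
- move=> x y /mul_idealP [g [gM ->]] /mul_idealP [h [hM ->]].
  apply/mul_idealP; exists (fun i => g i + h i); split.
    by move=> i lti; apply: MD; [apply: gM | apply: hM].
  by rewrite -big_split; apply: eq_bigr => i _; rewrite mulrDr.
move=> r x /mul_idealP [g [gM ->]].
apply/mul_idealP; exists (fun i => r * g i); split=> [i /gM /MM|] //.
by rewrite mulr_sumr; apply: eq_bigr => i _; rewrite mulrCA.
Qed.

Lemma predT_is_ideal : is_ideal (fun x => x \in (predT : {pred R})).
Proof. by []. Qed.

Lemma mem_mul_ideal fs x : x \in fs -> mul_ideal fs predT x.
Proof.
move=> xfs; exists (fun i => (i == index x fs :> nat)%:R); split=> //.
have lti : (index x fs < size fs)%N by rewrite index_mem.
rewrite (bigD1 (Ordinal lti)) //= nth_index // eqxx mulr1 big1 ?addr0 // => i.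
by rewrite -val_eqE /= => /negbTE ->; rewrite mulr0.
Qed.

Lemma mul_ideal_min fs P :
  is_ideal P -> {in fs, forall x, P x} -> forall x, mul_ideal fs predT x -> P x.
Proof.
move=> [P0 PD PM] Pfs x [g [_ ->]]; apply: big_ind => // i _.
by rewrite mulrC; apply: PM; apply: Pfs; apply: mem_nth.
Qed.

End Ideals.

(** * The Koszul complex and its depth sensitivity *)

Section Koszul.
Variable R : comNzRingType.
Implicit Types (gs : seq R) (P : R -> Prop).

(* The Koszul complex of [g :: gs] as the cone of multiplication by [g] on the
   complex of [gs]. *)
Fixpoint koszul gs : lmodType R :=
  if gs is _ :: gs' then (koszul gs' * koszul gs')%type : lmodType R else R^o.

(** A pair [c] stands for [c.1 + e_g c.2]; the sign comes from moving the differential past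
    [e_g]. *)
Fixpoint kd gs : koszul gs -> koszul gs :=
  if gs is g :: gs' then
    fun c : koszul (g :: gs') => (kd c.1 + g *: c.2, - kd c.2)
  else fun=> 0.

(** Left exterior multiplication by the degree-one element with coordinates [r]. *)
Fixpoint kh gs (r : nat -> R) : koszul gs -> koszul gs :=
  if gs is g :: gs' then
    fun c : koszul (g :: gs') =>
      (kh (fun i => r i.+1) c.1, r 0 *: c.1 - kh (fun i => r i.+1) c.2)
  else fun=> 0.

(** Ideals enter as conditions on coefficients, so that chains over an ideal, or modulo one, need no
    complex of their own. *)
Fixpoint kin P gs : koszul gs -> Prop :=
  if gs is g :: gs' then fun c : koszul (g :: gs') => kin P c.1 /\ kin P c.2
  else fun c : R => P c.

(* Chains all of whose components have homological degree at least [i]. *)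
Fixpoint kge i gs : koszul gs -> Prop :=
  if gs is g :: gs' then
    fun c : koszul (g :: gs') => kge i c.1 /\ kge i.-1 c.2
  else fun c : R => (0 < i)%N -> c = 0.

Lemma kd_is_linear gs : linear (@kd gs).
Proof.
elim: gs => [|g gs IH] r x y /=; first by rewrite scaler0 addr0.
congr pair; rewrite /= !IH.
  by rewrite !scalerDr !scalerA (mulrC r g) addrACA.
by rewrite opprD scalerN.
Qed.
HB.instance Definition _ gs :=
  GRing.isLinear.Build R (koszul gs) (koszul gs) *:%R (@kd gs) (@kd_is_linear gs).

Lemma kh_is_linear gs (r : nat -> R) : linear (@kh gs r).
Proof.
elim: gs r => [|g gs IH] r s x y /=; first by rewrite scaler0 addr0.
congr pair; rewrite /= !IH // !scalerDr !scalerA scalerN (mulrC s) opprD.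
by rewrite addrACA.
Qed.
HB.instance Definition _ gs r :=
  GRing.isLinear.Build R (koszul gs) (koszul gs) *:%R (@kh gs r)
    (@kh_is_linear gs r).

Lemma kd_kd gs (c : koszul gs) : kd (kd c) = 0.
Proof.
elim: gs c => [|g gs IH] c //=.
congr pair; rewrite /= ?linearN ?linearD ?linearZ /= !IH ?oppr0 //.
by rewrite add0r scalerN subrr.
Qed.

(** The differential is an antiderivation of the exterior algebra. Hence every element of the ideal
    generated by [gs] acts null-homotopically. *)
Lemma kd_kh gs r (c : koszul gs) :
  kd (kh r c) + kh r (kd c) = (\sum_(i < size gs) gs`_i * r i) *: c.
Proof.
elim: gs r c => [|g gs IH] r c /=.
  by rewrite big_ord0 scale0r addr0.
rewrite big_ord_recl /= scalerDl.
set s := \sum_(i < _) _.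
have IHs (x : koszul gs) : kd (kh (fun i => r i.+1) x) + kh (fun i => r i.+1) (kd x) = s *: x.
  exact: IH.
case: c => a b; congr pair => /=; rewrite -IHs !linearE /= !linearE /=.
  rewrite scalerN scalerA [X in _ + X]addrC !addrA subrK.
  by congr (_ + _); apply: addrC.
rewrite !linearN !opprK /= scalerA (mulrC (r 0)) [X in X + _]addrC !addrA subrK.
by congr (_ + _); apply: addrC.
Qed.

Section Kin.
Variables (P : R -> Prop) (idP : is_ideal P).

Lemma kin0 gs : kin P (0 : koszul gs).
Proof. by case: idP => P0 _ _; elim: gs => //= g gs IH; split. Qed.

Lemma kinD gs (x y : koszul gs) : kin P x -> kin P y -> kin P (x + y).
Proof.
case: idP => _ PD _; elim: gs x y => /= [|g gs IH] x y; first exact: PD.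
by move=> [? ?] [? ?]; split; apply: IH.
Qed.

Lemma kinZ gs r (x : koszul gs) : kin P x -> kin P (r *: x).
Proof.
case: idP => _ _ PM; elim: gs x => /= [|g gs IH] x; first exact: PM.
by move=> [? ?]; split; apply: IH.
Qed.

Lemma kinN gs (x : koszul gs) : kin P x -> kin P (- x).
Proof. by rewrite -scaleN1r; apply: kinZ. Qed.

Lemma kin_kd gs (x : koszul gs) : kin P x -> kin P (kd x).
Proof.
elim: gs x => [|g gs IH] x /= => [_|[x1 x2]]; first by case: idP.
by split; [apply: kinD; [apply: IH | apply: kinZ] | apply/kinN/IH].
Qed.

Lemma kin_kh gs r (x : koszul gs) : kin P x -> kin P (kh r x).
Proof.
elim: gs r x => [|g gs IH] r x /= => [_|[x1 x2]]; first by case: idP.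
by split; [apply: IH | apply: kinD; [apply: kinZ | apply/kinN/IH]].
Qed.

End Kin.

Lemma sub_kin P Q gs (x : koszul gs) :
  (forall p, P p -> Q p) -> kin P x -> kin Q x.
Proof.
move=> PQ; elim: gs x => [|g gs IH] x /=; first exact: PQ.
by move=> [? ?]; split; apply: IH.
Qed.

Lemma kin_eq0 gs (x : koszul gs) : kin (fun r => r = 0) x -> x = 0.
Proof.
elim: gs x => [|g gs IH] x //= [/IH x1 /IH x2].
by rewrite [x]surjective_pairing x1 x2.
Qed.

Lemma kge0 i gs : kge i (0 : koszul gs).
Proof. by elim: gs i => //= g gs IH i; split. Qed.

Lemma kgeD i gs (x y : koszul gs) : kge i x -> kge i y -> kge i (x + y).
Proof.
elim: gs i x y => /= [|g gs IH] i x y.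
  by move=> hx hy i0; rewrite hx // hy // addr0.
by move=> [? ?] [? ?]; split; apply: IH.
Qed.

Lemma kgeZ i gs r (x : koszul gs) : kge i x -> kge i (r *: x).
Proof.
elim: gs i x => /= [|g gs IH] i x.
  by move=> hx i0; rewrite hx // scaler0.
by move=> [? ?]; split; apply: IH.
Qed.

Lemma kgeN i gs (x : koszul gs) : kge i x -> kge i (- x).
Proof. by rewrite -scaleN1r; apply: kgeZ. Qed.

Lemma kge_leq i j gs (x : koszul gs) : (i <= j)%N -> kge j x -> kge i x.
Proof.
elim: gs i j x => /= [|g gs IH] i j x le_ij.
  by move=> hx i0; apply: hx; apply: leq_trans le_ij.
by move=> [? ?]; split; [apply: (IH i j) | apply: (IH i.-1 j.-1) => //; lia].
Qed.

Lemma kge_kd i gs (x : koszul gs) : kge i x -> kge i.-1 (kd x).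
Proof.
elim: gs i x => //= g gs IH i x [x1 x2]; split.
  by apply: kgeD; [apply: IH | apply: kgeZ].
by apply/kgeN/IH.
Qed.

Lemma kge_kh i gs r (x : koszul gs) : kge i x -> kge i.+1 (kh r x).
Proof.
elim: gs i r x => //= g gs IH i r x [x1 x2]; split; first exact: IH.
apply: kgeD; first exact: kgeZ.
by apply/kgeN; apply: (@kge_leq i i.-1.+1); [lia | apply: IH].
Qed.

Lemma kge_eq0 i gs (x : koszul gs) : (size gs < i)%N -> kge i x -> x = 0.
Proof.
elim: gs i x => /= [|g gs IH] i x lti; first exact.
move=> [/IH x1 /IH x2]; rewrite [x]surjective_pairing x1 ?x2 //; lia.
Qed.

(** The splitting is chosen component by component; where the degree bound forces a component to
    vanish, both parts are taken to be [0], which keeps [z] in degree at least [i]. *)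
Lemma kin_split f A B i gs (x : koszul gs) :
  is_ideal A -> is_ideal B ->
  kge i x -> kin (fun p => exists q a, [/\ B q, A a & p = q + f * a]) x ->
  exists y z, [/\ kin B y, kin A z, kge i z & x = y + f *: z].
Proof.
move=> [A0 _ _] [B0 _ _]; elim: gs i x => /= [|g gs IH] i x.
  case: i => [|i] hx [q [a [Bq Aa ex]]].
    by exists q, a.
  by exists 0, 0; split=> //; rewrite scaler0 addr0; apply: hx.
case: x => x1 x2 /= [g1 g2] [k1 k2].
have [y1 [z1 [? ? ? ->]]] := IH _ _ g1 k1.
have [y2 [z2 [? ? ? ->]]] := IH _ _ g2 k2.
by exists (y1, y2), (z1, z2); split.
Qed.

Lemma kin_cancel f A B gs (x : koszul gs) :
  (forall p, A p -> B (f * p) -> B p) -> kin A x -> kin B (f *: x) -> kin B x.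
Proof.
move=> h; elim: gs x => [|g gs IH] x /=; first exact: h.
by move=> [? ?] [? ?]; split; apply: IH.
Qed.

(* Depth sensitivity: multiplication by [f] is null-homotopic, so a cycle [c]
   of [A / B] becomes, after multiplication by [f], the boundary of [kh r c];
   modulo [f] this is itself a cycle, of higher degree. *)
Lemma koszul_acyclic (A : {pred R}) fs gs k i (c : koszul gs) :
  is_ideal (fun x => x \in A) -> regular_sequence A fs ->
  {in fs, forall f, mul_ideal gs predT f} ->
  (k <= size fs)%N -> (size gs + k < i + size fs)%N ->
  kge i c -> kin (fun x => x \in A) c -> kin (mul_ideal (take k fs) A) (kd c) ->
  exists a : koszul gs, [/\ kge i.+1 a, kin (fun x => x \in A) a
    & kin (mul_ideal (take k fs) A) (c - kd a)].
Proof.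
(* Induction on the number of elements of [fs] not yet divided out: the case [k.+1] yields the case
   [k]. *)
move=> idA [reg _] fsgs; move: {2}(size fs - k)%N (leqnn (size fs - k)) => b.
have idB j : is_ideal (mul_ideal (take j fs) A) by apply: mul_ideal_is_ideal.
elim: b k i c => [|b IH] k i c leb lek ltk ci cA dcB.
  (* Here [k = size fs], so [i] exceeds the top degree [size gs]. *)
  have c0 : c = 0 by apply: kge_eq0 ci; lia.
  exists 0; split; [exact: kge0 | exact: kin0 | ].
  by rewrite c0 linear0 subr0; apply: kin0.
have [ltkf|] := ltnP k (size fs); last first.
  by move=> lefk; apply: (IH k) => //; lia.
pose f := fs`_k.
have /fsgs/mul_idealP [r [_ fE]] : f \in fs by apply: mem_nth.
have hE : kd (kh r c) = f *: c - kh r (kd c).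
  by have := kd_kh r c; rewrite -fE => <-; rewrite addrK.
have takeS : take k.+1 fs = rcons (take k fs) f by rewrite (take_nth 0).
have subB p : mul_ideal (take k fs) A p -> mul_ideal (take k.+1 fs) A p.
  rewrite takeS => Bp; apply/mul_ideal_rcons; exists p, 0; split=> //.
    by case: idA.
  by rewrite mulr0 addr0.
have fB p : p \in A -> mul_ideal (take k.+1 fs) A (f * p).
  rewrite takeS => Ap; apply/mul_ideal_rcons; exists 0, p; split=> //.
    by case: (idB k).
  by rewrite add0r.
(* Once [f] is divided out too, [kh r c] is a cycle one degree higher, hence a boundary [kd e]
   modulo the larger ideal. *)
have [||||||e [ei eA heB]] := IH k.+1 i.+1 (kh r c).
- lia.
- lia.
- lia.
- exact: kge_kh.
- exact: kin_kh.
- rewrite hE; apply: kinD => //.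
    elim: (gs) c cA {ci dcB hE} => /= [|g gs' IHg] c; first exact: fB.
    by move=> [? ?]; split; apply: IHg.
  by apply/kinN/kin_kh => //; apply: sub_kin dcB.
have {}heB : kin (fun p => exists q a, [/\ mul_ideal (take k fs) A q, a \in A
    & p = q + f * a]) (kh r c - kd e).
  by apply: sub_kin heB => p; rewrite takeS => /mul_ideal_rcons.
(* Applying [kd] to [kh r c - kd e = q + f *: a] shows that [f *: (c - kd a)] has coefficients in
   the smaller ideal; regularity then cancels [f]. *)
have [|q [a [qB aA ai eE]]] := kin_split idA (idB k) (i := i.+1) _ heB.
  by apply: kgeD; [apply: kge_kh | apply/kgeN; apply: (@kge_kd i.+2)].
exists a; split=> //; apply: (@kin_cancel f (fun x => x \in A)).
- by move=> p pA; apply: reg.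
- by apply: kinD => //; apply/kinN => //; apply: kin_kd.
have : kd (kh r c - kd e) = kd q + f *: kd a by rewrite eE linearD linearZ.
rewrite linearB /= kd_kd subr0 hE => /(canRL (subrK _)) fc.
rewrite scalerBr fc addrAC addrK.
by apply: kinD => //; [apply: kin_kd | apply: kin_kh].
Qed.

End Koszul.

(** * Bounding regular sequences by a nonzero Koszul class *)

Section Facet.
Variables (R : comNzRingType) (R' : idomainType) (pi : {rmorphism R -> R'}).
Implicit Types os gs : seq R.

(* The face using all of [gs] and none of [os]. *)
Fixpoint facet os gs (z : R) : koszul (os ++ gs) :=
  match os return koszul (os ++ gs) with
  | o :: os' => (facet os' gs z, 0)
  | [::] => (fix top gs : koszul gs :=
      if gs is _ :: gs' then (0, top gs') else z) gs
  end.

Fixpoint facet_coef os gs : koszul (os ++ gs) -> R :=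
  match os return koszul (os ++ gs) -> R with
  | o :: os' => fun c : koszul (o :: os' ++ gs) => facet_coef c.1
  | [::] => (fix top gs : koszul gs -> R :=
      if gs is g :: gs' then fun c : koszul (g :: gs') => top gs' c.2
      else fun c : R => c) gs
  end.

(* The face using all of [gs] but neither [g] nor [os]. *)
Fixpoint ridge_coef os g gs : koszul (os ++ g :: gs) -> R :=
  match os return koszul (os ++ g :: gs) -> R with
  | o :: os' => fun c : koszul (o :: os' ++ g :: gs) => ridge_coef c.1
  | [::] => fun c : koszul (g :: gs) => facet_coef (os := [::]) c.1
  end.

Lemma facet_coef_linear os gs (r : R) x y :
  facet_coef (r *: x + y : koszul (os ++ gs)) =
  r * facet_coef x + facet_coef y.
Proof. by elim: os x y => //=; elim: gs => //= g gs IH x y; apply: IH. Qed.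

Lemma facet_coefZ os gs (r : R) x :
  facet_coef (r *: x : koszul (os ++ gs)) = r * facet_coef x.
Proof. by elim: os x => //=; elim: gs => //= g gs IH x; apply: IH. Qed.

Lemma ridge_coef_linear os g gs (r : R) x y :
  ridge_coef (r *: x + y : koszul (os ++ g :: gs)) =
  r * ridge_coef x + ridge_coef y.
Proof. by elim: os x y => //= x y; apply: (@facet_coef_linear [::]). Qed.

Lemma kin_facet_coef P os gs (c : koszul (os ++ gs)) :
  kin P c -> P (facet_coef c).
Proof.
elim: os c => [|o os IH] c /=; last by move=> [/IH].
by elim: gs c => [|g gs IH] c //= [_ /IH].
Qed.

Lemma facet_coefK os gs z : facet_coef (facet os gs z) = z.
Proof. by elim: os => //=; elim: gs. Qed.

Lemma kge_facet os gs z : kge (size gs) (facet os gs z).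
Proof.
elim: os => [|o os IH] /=; last by split=> //; apply: kge0.
by elim: gs => //= g gs IH; split=> //; apply: kge0.
Qed.

Lemma kin_kd_facet P os gs z : is_ideal P -> {in gs, forall g, P (g * z)} ->
  kin P (kd (facet os gs z)).
Proof.
move=> idP; elim: os => [|o os IH] /= gsP; last first.
  rewrite scaler0 addr0 linear0 oppr0; split; [exact: IH | exact: kin0].
elim: gs gsP => [|g gs IH] gsP /=; first by case: idP.
split; last first.
  by apply: kinN => //; apply: IH => h hgs; apply: gsP; rewrite inE hgs orbT.
rewrite linear0 add0r.
have : P (g * z) by apply: gsP; rewrite mem_head.
elim: (gs) => //= h gs' IHgs Pgz; split; last exact: IHgs.
by rewrite scaler0; apply: kin0.
Qed.

(** A face whose boundary meets this ridge adds to it either [g] or an element of [os], and [pi]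
    kills the latter contributions. *)
Lemma ridge_coef_kd os g gs (c : koszul (os ++ g :: gs)) :
  {in os, forall o, pi o = 0} -> kge (size gs).+1 c ->
  pi (ridge_coef (kd c)) = pi g * pi (facet_coef c).
Proof.
elim: os c => [|o os IH] c osP /=.
  move=> [c1 _]; rewrite [c.1](kge_eq0 _ c1) // linear0 add0r.
  by rewrite -rmorphM; congr (pi _); apply: (@facet_coefZ [::]).
move=> [c1 _]; rewrite addrC ridge_coef_linear rmorphD rmorphM.
rewrite osP ?mem_head // mul0r add0r IH // => h hos.
by apply: osP; rewrite inE hos orbT.
Qed.

(* The boundary of the facet [z] is a cycle with coefficients in [A] which
   bounds in [R] but, as seen through [pi], not in [A]. *)
Lemma regular_sequence_size (A : {pred R}) fs os g gs z :
  is_ideal (fun x => x \in A) -> regular_sequence A fs ->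
  {in fs, forall f, mul_ideal (os ++ g :: gs) predT f} ->
  {in os, forall o, pi o = 0} -> pi g != 0 ->
  {in g :: gs, forall h, h * z \in A} -> (forall a, a \in A -> pi a != pi z) ->
  (size fs <= (size os).+1)%N.
Proof.
move=> idA reg fsgs osP g0 gzA zA; rewrite leqNgt; apply/negP => ltfs.
pose c := facet os (g :: gs) z.
have ci : kge (size gs).+1 c by apply: (kge_facet os (g :: gs)).
have dcA : kin (fun x => x \in A) (kd c) by apply: kin_kd_facet.
(* For [k = 0] the ideal divided out is zero, so [kd c] is exactly the boundary of a chain [b] over
   [A]. *)
have [|||b [bi bA]] := koszul_acyclic (k := 0) (i := size gs) idA reg fsgs _ _
  (kge_kd ci) dcA.
- by [].
- by rewrite size_cat /=; lia.
- by rewrite kd_kd; apply: kin0; apply: mul_ideal_is_ideal.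
rewrite take0 => /(sub_kin (fun p => (mul_ideal_nil A p).1)) /kin_eq0.
move/eqP; rewrite subr_eq0 => /eqP dcb.
(* Comparing ridge coefficients and cancelling [pi g] exhibits [pi z] as the image of an element of
   [A]. *)
have := ridge_coef_kd osP ci; rewrite dcb ridge_coef_kd // => /(mulfI g0).
by rewrite facet_coefK; apply/eqP/zA/(kin_facet_coef bA).
Qed.

End Facet.

(** * Monomial ideals and complete intersections *)

Section MonomialIdeals.
Variables (K : fieldType) (n : nat).
Local Notation S := {mpoly K[n]}.
Implicit Types (u w a b : 'X_{1..n}) (v : seq 'X_{1..n}).

Lemma monomial_idealP v (p : S) :
  mul_ideal (monomials K v) predT p <->
  {in msupp p, forall a, has (fun u => (u <= a)%MM) v}.
Proof.
split=> hp.
  pose P (q : S) := {in msupp q, forall a, has (fun u => (u <= a)%MM) v}.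
  apply: (@mul_ideal_min _ (monomials K v) P) => [|_ /mapP [u uv ->] a|] //;
    last first.
    rewrite msuppX inE => /eqP ->; apply/hasP; exists u => //.
    exact: lepm_refl.
  split=> [a|p1 p2 h1 h2 a|q p1 h1 a].
  - by rewrite msupp0.
  - by move/msuppD_le; rewrite mem_cat => /orP [/h1|/h2].
  move/msuppM_le => /allpairsP [[a1 a2] /= [_ /h1 /hasP [u uv le_u] ->]].
  by apply/hasP; exists u => //; apply: lepm_trans le_u (lem_addl _ _).
rewrite [p]mpolyE big_seq.
have [I0 ID IM] := mul_ideal_is_ideal (monomials K v) (@predT_is_ideal S).
apply: big_ind => // a /hp /hasP [u uv le_u].
rewrite -(submK le_u) mpolyXD -mul_mpolyC mulrA; apply: IM.
by apply: mem_mul_ideal; apply: map_f.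
Qed.

Lemma generated_is_ideal (I : {pred S}) v :
  generated_by I v -> is_ideal (fun p => p \in I).
Proof.
move=> Iv; have [I0 ID IM] :=
  mul_ideal_is_ideal (monomials K v) (@predT_is_ideal S).
split; first exact/Iv.
  by move=> x y /Iv Ix /Iv Iy; apply/Iv/ID.
by move=> r x /Iv Ix; apply/Iv/IM.
Qed.

Lemma mem_generated (I : {pred S}) v a :
  generated_by I v -> 'X_[a] \in I = has (fun u => (u <= a)%MM) v.
Proof.
move=> Iv; apply/idP/idP => [/Iv/monomial_idealP|h].
  by apply; rewrite msuppX mem_head.
by apply/Iv/monomial_idealP => b; rewrite msuppX inE => /eqP ->.
Qed.

Section CompleteIntersection.
Variables (m : nat) (I : {pred S}) (v : m.-tuple 'X_{1..n}).

Lemma complete_intersection_gt0 :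
  monomial_complete_intersection I v -> (0 < m)%N.
Proof.
case=> [[p Ip p0] _ [Iv _] _]; case: m v Iv => // v' Iv.
by move: Ip => /Iv; rewrite (tuple0 v') => /mul_ideal_nil /eqP; rewrite (negbTE p0).
Qed.

Lemma complete_intersection_neq0 (k : 'I_m) :
  monomial_complete_intersection I v -> tnth v k != 0%MM.
Proof.
case=> [_ I1 [Iv _] _]; apply: contra I1 => /eqP v0.
rewrite -mpolyX0 (mem_generated _ Iv); apply/hasP.
by exists (tnth v k); [apply: mem_tnth | rewrite v0 lepm_refl].
Qed.

(** Suppose [x_i] divides [v_k] and [v_l] with [k < l]. Since [v_l (v_k / x_i) = (v_l / x_i) v_k],
    regularity puts [v_k / x_i] in the ideal of the generators before [v_l], which contradicts
    minimality. *)
Lemma complete_intersection_disjoint (k l : 'I_m) i :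
  monomial_complete_intersection I v ->
  tnth v k i != 0%N -> tnth v l i != 0%N -> k = l.
Proof.
move=> [_ _ [Iv vmin] [reg _]].
wlog ltkl : k l / (k < l)%N => [th vk vl|].
  by have [/th->|/th->|/val_inj] := ltngtP k l.
move=> vk vl.
have vkE : (tnth v k - U_(i) + U_(i) = tnth v k)%MM by rewrite submK ?lep1mP.
have vlE : (tnth v l - U_(i) + U_(i) = tnth v l)%MM by rewrite submK ?lep1mP.
have ltl : (l < size (monomials K v))%N by rewrite size_map size_tuple.
have := reg l ltl 'X_[tnth v k - U_(i)] isT.
rewrite -map_take (nth_map 0%MM) ?size_tuple // -tnth_nth.
case.
  have -> : 'X_[tnth v l] * 'X_[tnth v k - U_(i)]
    = 'X_[tnth v l - U_(i)] * 'X_[tnth v k] :> S.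
    rewrite -!mpolyXD; congr mpolyX.
    by rewrite -[X in (X + _)%MM]vlE -addmA (addmC U_(i)%MM) vkE.
  have [_ _ IM] := mul_ideal_is_ideal (monomials K (take l v)) (@predT_is_ideal S).
  apply: IM; apply: mem_mul_ideal; apply: map_f.
  rewrite (tnth_nth 0%MM) -(nth_take _ ltkl) mem_nth // size_take size_tuple.
  by rewrite ltn_ord.
move=> g gE; have {g gE} : mul_ideal (monomials K (take l v)) predT
    ('X_[tnth v k - U_(i)] : S) by exists g.
move/monomial_idealP/(_ (tnth v k - U_(i))%MM).
rewrite msuppX mem_head => /(_ isT) /hasP [u /mem_take uv leu].
(* The exponent of [v_k / x_i] at [i] is too small for [v_k] to divide it; so another generator [u]
   does, and [v_k] is redundant. *)
have uk : u != tnth v k.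
  apply: contraTneq leu => ->; apply/negP => /mnm_lepP /(_ i).
  by rewrite mnmBE mnm1E eqxx; move: vk; lia.
have uv' : u \in rem (tnth v k) v.
  by move: uv; rewrite (perm_mem (perm_to_rem (mem_tnth k v))) inE (negbTE uk).
case: (vmin (tnth v k) (mem_tnth k v)) => p; split.
  move/Iv/monomial_idealP => hp; apply/monomial_idealP => a /hp /hasP [w wv lew].
  apply/hasP; have [wE|wk] := eqVneq w (tnth v k).
    exists u => //; apply: lepm_trans lew.
    by rewrite wE; apply: lepm_trans leu (lem_subr _ _).
  exists w => //; move: wv.
  by rewrite (perm_mem (perm_to_rem (mem_tnth k v))) inE (negbTE wk).
move/monomial_idealP => hp; apply/Iv/monomial_idealP => a /hp /hasP [w wv lew].
by apply/hasP; exists w => //; apply: mem_rem wv.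
Qed.

End CompleteIntersection.

(** * The upper bound for the depth *)

Section DisjointSupports.
Variables (m : nat) (I : {pred S}) (v : m.-tuple 'X_{1..n}).
Hypotheses (m_gt0 : (0 < m)%N) (Iv : generated_by I v).
Hypothesis v_neq0 : forall k, tnth v k != 0%MM.
Hypothesis v_disj :
  forall k l i, tnth v k i != 0%N -> tnth v l i != 0%N -> k = l.

Lemma exists_support u : u != 0%MM -> exists i, u i != 0%N.
Proof.
move=> u0; apply/existsP; apply: contraNT u0; rewrite negb_exists => /forallP u0.
by apply/eqP/mnmP => i; rewrite mnm0E; apply/eqP; rewrite -[_ == _]negbK.
Qed.

(** Choose a variable [x_(f k)] in each [v_k] and let [zeta] be the product of the [v_k / x_(f k)].
    Every [x_(f k)] multiplies it into [I], yet it avoids [I] even after the variables of each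
    support are identified. *)
Lemma depth_le fs :
  regular_sequence I fs -> {in fs, forall f, irrelevant_ideal f} ->
  (size fs + m <= n.+1)%N.
Proof.
move=> reg fsx.
have [f fP] := fin_all_exists (fun k => exists_support (v_neq0 k)).
(* Variables outside all supports are sent to an arbitrary chosen variable. *)
have exists_tau j : exists t : 'I_n,
    t \in codom f /\ forall k, tnth v k j != 0%N -> t = f k.
  have [/existsP [k vk]|vj] := boolP [exists k, tnth v k j != 0%N].
    by exists (f k); split=> [|l vl]; [apply: codom_f | rewrite (v_disj vk vl)].
  exists (f (Ordinal m_gt0)); split=> [|l vl]; first exact: codom_f.
  by case/existsP: vj; exists l.
have [tau tauP] := fin_all_exists exists_tau.
have tauf k : tau (f k) = f k by have [_] := tauP (f k); apply.
have f_inj : injective f by move=> k l fkl; apply: (v_disj (fP k)); rewrite fkl.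
(* These [n - m] linear forms are killed by [pi], and with the chosen variables they generate the
   irrelevant ideal. *)
pose os : seq S := [seq 'X_j - 'X_(tau j) | j <- enum ([predC codom f])].
pose X k : S := 'X_(f k).
pose zeta := (\sum_k (tnth v k - U_(f k)))%MM.
pose phi a := (\sum_j U_(tau j) *+ a j)%MM.
pose pi : {rmorphism S -> S} := comp_mpoly [tuple ('X_(tau j) : S) | j < n].
have piX a : pi 'X_[a] = 'X_[phi a].
  rewrite /pi /= comp_mpolyX (big_morph _ (@mpolyXD _ _) (@mpolyX0 _ _)).
  by apply: eq_bigr => j _; rewrite tnth_mktuple mpolyXn.
have phiE a i : phi a i = (\sum_j (tau j == i) * a j)%N.
  by rewrite mnm_sumE; apply: eq_bigr => j _; rewrite mulmnE mnm1E.
have piXj j : pi 'X_j = 'X_(tau j).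
  by rewrite /pi /= comp_mpolyXU -tnth_nth tnth_mktuple.
have size_os : (size os + m = n)%N.
  have cardf : #|codom f| = m by rewrite (card_codom f_inj) card_ord.
  by rewrite size_map -cardE -[X in (_ + X)%N]cardf addnC cardC card_ord.
have memS k : X k * 'X_[zeta] \in I.
  rewrite -mpolyXD (mem_generated _ Iv); apply/hasP; exists (tnth v k).
    exact: mem_tnth.
  apply/mnm_lepP => i; rewrite mnmDE mnm_sumE (bigD1 k) //= mnmBE; lia.
have piI (a : S) : a \in I -> pi a != pi 'X_[zeta].
  move=> /Iv aI; apply/eqP => piE.
  have : mul_ideal (monomials K (map phi v)) predT (pi a).
    have [I0 ID IM] :=
      mul_ideal_is_ideal (monomials K (map phi v)) (@predT_is_ideal S).
    pose P (q : S) := mul_ideal (monomials K (map phi v)) predT (pi q).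
    suff : P a by [].
    apply: mul_ideal_min aI.
      split=> [|x y Px Py|r x Px]; rewrite /P /pi ?rmorph0 // ?rmorphD ?rmorphM.
        exact: ID.
      exact: IM.
    move=> _ /mapP [u uv ->]; rewrite /P piX; apply: mem_mul_ideal.
    by apply/map_f/map_f.
  rewrite piE piX => /monomial_idealP /(_ (phi zeta)).
  rewrite msuppX mem_head => /(_ isT); rewrite has_map => /hasP [_ /tnthP [k ->]].
  (* At [f k] the image of [v_k] has exponent [mdeg (tnth v k)], while that of [zeta] has a smaller
     one. *)
  move=> /mnm_lepP /(_ (f k)); apply/negP; rewrite -ltnNge !phiE.
  have le1 : (U_(f k) <= tnth v k)%MM by rewrite lep1mP.
  rewrite [X in (_ < X)%N](_ : _ = mdeg (tnth v k)); last first.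
    rewrite mdegE; apply: eq_bigr => j _; have [_ tj] := tauP j.
    by have [->|/tj ->] := eqVneq (tnth v k j) 0%N; rewrite ?muln0 // eqxx mul1n.
  rewrite -(submK le1) mdegD mdeg1 addn1 ltnS mdegE leq_sum // => j _.
  have [tE|] := eqVneq (tau j) (f k); last by rewrite mul0n.
  rewrite mul1n mnm_sumE (bigD1 k) //= big1 ?addn0 // => l lk.
  rewrite mnmBE; apply/eqP; rewrite subn_eq0.
  have [->|vl] := eqVneq (tnth v l j) 0%N; first by [].
  have [_ /(_ l vl) tl] := tauP j; move: tE; rewrite tl => /f_inj lE.
  by rewrite lE eqxx in lk.
have fsgs h : h \in fs -> mul_ideal (os ++ [seq X k | k <- enum 'I_m]) predT h.
  move/fsx; have idg := mul_ideal_is_ideal (os ++ [seq X k | k <- enum 'I_m])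
    (@predT_is_ideal S).
  apply: mul_ideal_min => // _ /mapP [j _ ->].
  have Xc j' : j' \in codom f ->
      mul_ideal (os ++ [seq X k | k <- enum 'I_m]) predT ('X_j' : S).
    case/codomP => k ->; apply: mem_mul_ideal; rewrite mem_cat orbC.
    by rewrite (map_f X) // mem_enum.
  have [jc|jc] := boolP (j \in codom f); first exact: Xc.
  have [tj _] := tauP j; have [_ ID _] := idg.
  rewrite -['X_j](subrK 'X_(tau j)); apply: ID; last exact: Xc.
  apply: mem_mul_ideal; rewrite mem_cat; apply/orP; left.
  by apply: (map_f (fun j => 'X_j - 'X_(tau j))); rewrite mem_enum.
have osP : {in os, forall o, pi o = 0}.
  move=> _ /mapP [j _ ->]; have [/codomP [k tj] _] := tauP j.
  by rewrite /pi rmorphB /= -!/(pi _) !piXj tj tauf subrr.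
have idI := generated_is_ideal Iv.
(* One chosen variable serves as [g] and the other [m - 1] as [gs], so the bound is [n - m + 1]. *)
case E : (enum 'I_m) fsgs => [|k ks] fsgs.
  by have := size_enum_ord m; rewrite E /=; move: m_gt0; lia.
suff : (size fs <= (size os).+1)%N by lia.
apply: (@regular_sequence_size _ _ pi _ _ _ _ _ 'X_[zeta] idI reg fsgs osP) => //.
  by rewrite piXj tauf -msupp_eq0 msuppX.
move=> h; rewrite -[X k :: _]/(map X (k :: ks)) -E => /mapP [l _ ->].
exact: memS.
Qed.

End DisjointSupports.
End MonomialIdeals.

(** * Stanley decompositions as partitions of monomials *)

Section Stanley.
Variables (K : fieldType) (n : nat).
Local Notation S := {mpoly K[n]}.
Local Notation cell := ('X_{1..n} * {set 'I_n})%type.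
Implicit Types (u w a b : 'X_{1..n}) (Z : {set 'I_n}) (c : cell).

(** Boolean, so that the cells containing a monomial can be counted by a sum. *)
Definition in_cell c a : bool :=
  [forall i, if i \in c.2 then (c.1 i <= a i)%N else a i == c.1 i].

Lemma in_cellP c a : reflect
  (forall i, if i \in c.2 then (c.1 i <= a i)%N else a i == c.1 i) (in_cell c a).
Proof. exact: forallP. Qed.

Lemma stanley_spaceP u Z (p : S) :
  stanley_space u Z p <-> {in msupp p, forall a, in_cell (u, Z) a}.
Proof.
split=> h a /h => [[w wZ ->]|/in_cellP /= aP].
  apply/in_cellP => i /=; rewrite mnmDE; case: ifP => [_|/negbT /wZ ->].
    exact: leq_addr.
  by rewrite addn0.
exists (a - u)%MM => [i iZ|].
  by have := aP i; rewrite (negbTE iZ) mnmBE => /eqP ->; rewrite subnn.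
rewrite addmC submK //; apply/mnm_lepP => i; have := aP i.
by case: ifP => // _ /eqP ->.
Qed.

Lemma sum_nat_eq1P (T : finType) (P : pred T) :
  (\sum_i P i = 1)%N <-> exists2 i, P i & forall j, P j -> j = i.
Proof.
split=> [|[i Pi Pu]]; last first.
  rewrite (bigD1 i) //= Pi big1 // => j ji.
  by case Pj : (P j); rewrite // (Pu j Pj) eqxx in ji.
move=> h; have [/existsP [i Pi]|/existsPn P0] := boolP [exists i, P i]; last first.
  by move: h; rewrite big1 // => i _; rewrite (negbTE (P0 i)).
exists i => // j Pj; apply: contra_eq h => ji.
by rewrite (bigD1 i) //= (bigD1 j) //= Pi Pj.
Qed.

Lemma mcoeff_restrict (P : pred 'X_{1..n}) (p : S) a :
  (\sum_(b <- msupp p | P b) p@_b *: 'X_[b])@_a = if P a then p@_a else 0.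
Proof.
rewrite [in RHS](mpolyE p) !raddf_sum big_mkcond /=.
case: ifP => Pa; last first.
  apply: big1 => b _; case: ifP => // Pb; rewrite mcoeffZ mcoeffX.
  have [bE|_] := eqVneq b a; last by rewrite mulr0.
  by rewrite -bE Pb in Pa.
apply: eq_bigr => b _; case: ifP => // Pb; rewrite mcoeffZ mcoeffX.
have [bE|_] := eqVneq b a; last by rewrite mulr0.
by rewrite bE Pa in Pb.
Qed.

(** All spaces involved are spanned by monomials, so directness can be tested on monomials: those of
    [I] lie in exactly one cell, the others in none. *)
Lemma stanley_decompositionP (I : {pred S}) v r (D : 'I_r -> cell) :
  generated_by I v ->
  stanley_decomposition I D <->
  forall a, (\sum_i in_cell (D i) a)%N = ('X_[a] \in I).
Proof.
move=> Iv.
have spaceX i a : in_cell (D i) a -> stanley_space (D i).1 (D i).2 ('X_[a] : S).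
  move=> ia; apply/stanley_spaceP => b; rewrite msuppX inE => /eqP ->.
  by rewrite -surjective_pairing.
have spaceP i (p : S) : stanley_space (D i).1 (D i).2 p <->
    {in msupp p, forall a, in_cell (D i) a}.
  by rewrite stanley_spaceP -surjective_pairing.
split=> [[DI dec] a|DI].
  have cellI i : in_cell (D i) a -> 'X_[a] \in I by move/spaceX/DI.
  have [aI|aI] := boolP ('X_[a] \in I); last first.
    by rewrite big1 // => i _; case ia : (in_cell _ _); rewrite // (cellI i) in aI.
  apply/sum_nat_eq1P; have [f [[fD fE] funiq]] := dec _ aI.
  have [i ia] : exists i, in_cell (D i) a.
    apply/existsP; apply: contraT; rewrite negb_exists => /forallP na.
    have := mcoeffX K a a; rewrite {1}fE raddf_sum big1 => [|i _] /=.
      by move/eqP; rewrite eqxx eq_sym oner_eq0.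
    apply: memN_msupp_eq0; apply: contra (na i).
    by move/spaceP: (fD i); apply.
  (* Each cell containing [a] gives a decomposition of ['X_[a]] concentrated there; uniqueness makes
     these cells equal. *)
  have single j : in_cell (D j) a ->
      f = [ffun k => if k == j then 'X_[a] else 0].
    move=> ja; apply: funiq; split=> [k|].
      rewrite ffunE; case: eqP => [->|_]; first exact: spaceX.
      by apply/spaceP => b; rewrite msupp0.
    rewrite (bigD1 j) //= ffunE eqxx big1 ?addr0 // => k /negbTE kj.
    by rewrite ffunE kj.
  exists i => // j ja; have := single j ja; rewrite (single i ia).
  move/ffunP/(_ j); rewrite !ffunE eqxx; case: eqP => // _ /eqP.
  by rewrite eq_sym -msupp_eq0 msuppX.
have IP (p : S) : p \in I <-> {in msupp p, forall a, 'X_[a] \in I}.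
  rewrite (Iv p) monomial_idealP.
  by split=> h a /h; rewrite (mem_generated _ Iv).
split=> [i p /spaceP pi|p /IP pI].
  apply/IP => a /pi ia; move: (DI a); rewrite (bigD1 i) //= ia.
  by case: (_ \in I).
pose f := [ffun i => \sum_(a <- msupp p | in_cell (D i) a) p@_a *: 'X_[a]] :
  {ffun 'I_r -> S}.
have fE i a : (f i)@_a = if in_cell (D i) a then p@_a else 0.
  by rewrite ffunE mcoeff_restrict.
exists f; split; first split=> [i|].
- apply/spaceP => a; rewrite mcoeff_msupp fE; case: ifP => //.
  by rewrite eqxx.
- apply/mpolyP => a; rewrite raddf_sum /=.
  transitivity (p@_a *+ (\sum_i in_cell (D i) a)).
    rewrite DI; have [/pI ->|/memN_msupp_eq0 ->] := boolP (a \in msupp p).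
      by rewrite mulr1n.
    by rewrite mul0rn.
  rewrite -sumrMnr; apply: eq_bigr => i _; rewrite fE.
  by case: (in_cell _ _).
move=> g [gD pE]; apply/ffunP => i; apply/mpolyP => a; rewrite fE.
have gN j : ~~ in_cell (D j) a -> (g j)@_a = 0.
  move=> ja; apply: memN_msupp_eq0; apply: contra ja.
  by move/spaceP: (gD j); apply.
case: ifP => [ia|/negbT /gN //].
rewrite pE raddf_sum (bigD1 i) //= big1 ?addr0 // => j ji; apply: gN.
apply: contra ji => ja; apply/eqP.
have : (\sum_i in_cell (D i) a)%N = 1%N.
  by rewrite DI; move: (DI a); rewrite (bigD1 i) //= ia; case: (_ \in I).
by case/sum_nat_eq1P => k _ ku; rewrite (ku j ja) (ku i ia).
Qed.

Lemma bigminn_le (T : finType) (F : T -> nat) x j :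
  (\big[minn/x]_i F i <= F j)%N.
Proof.
have : j \in index_enum T by rewrite mem_index_enum.
elim: (index_enum T) => // i s IH; rewrite inE big_cons => /orP [/eqP <-|/IH].
  exact: geq_minl.
exact: leq_trans (geq_minr _ _).
Qed.

Lemma leq_bigminn (T : finType) (F : T -> nat) x y :
  (y <= x)%N -> (forall i, y <= F i)%N -> (y <= \big[minn/x]_i F i)%N.
Proof.
by move=> yx yF; elim/big_ind: _ => // a b ya yb; rewrite leq_min ya yb.
Qed.

(* Removes from the cell [c] the multiples of [w], sorting the remaining
   monomials by the first variable [s] in which [w] fails to divide and by the
   exponent [t] of that variable. *)
Definition slice w c (x : 'I_n * nat) : cell :=
  ([multinom (if (i < x.1)%N then w i else if i == x.1 then x.2 else 0) + c.1 i
     | i < n]%N, c.2 :\ x.1).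

Definition slices w : seq ('I_n * nat) :=
  [seq (s, t) | s <- enum 'I_n, t <- iota 0 (w s)].

(** On the support of [w] the cell is free and starts at exponent 0, so the slice only adds
    conditions on [a] itself. *)
Lemma in_slice w c s t a :
  (forall i, w i != 0%N -> i \in c.2 /\ c.1 i = 0%N) -> w s != 0%N ->
  in_cell (slice w c (s, t)) a =
  [&& in_cell c a, [forall i : 'I_n, (i < s)%N ==> (w i <= a i)%N] & a s == t].
Proof.
move=> wc ws; have [sZ us] := wc s ws.
have E (i : 'I_n) : (i < s)%N -> i != s.
  by apply: contraTneq => ->; rewrite ltnn.
apply/in_cellP/and3P => [h|[/in_cellP ca /forallP wa /eqP sa] i].
  have hs : a s == t by have := h s; rewrite /= mnmE ltnn !inE eqxx us addn0.
  split=> //.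
    apply/in_cellP => i; have := h i; rewrite /= mnmE !inE.
    have [->|/= ns] := eqVneq i s; first by rewrite sZ us.
    case: ifP => iZ; first by case: ifP; lia.
    have -> : w i = 0%N by apply/eqP; apply: contraFT iZ => /wc [].
    by rewrite if_same.
  apply/forallP => i; apply/implyP => lti.
  have := h i; rewrite /= mnmE !inE lti (E i lti) /=.
  have [->|wi] := eqVneq (w i) 0%N; first by [].
  by have [-> ->] := wc i wi; rewrite addn0.
have := ca i; rewrite /= mnmE !inE.
have [->|/= ns] := eqVneq i s; first by rewrite ltnn us addn0 sa /= eqxx.
have [lti|//] := boolP (i < s)%N; have := wa i; rewrite lti /=.
have [->|wi] := eqVneq (w i) 0%N; first by [].
by have [-> ->] := wc i wi; rewrite addn0.
Qed.

(** A non-multiple of [w] has one first failing variable [s], and then [t = a s]; a multiple of [w]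
    has none. *)
Lemma sum_in_slices w c a :
  (forall i, w i != 0%N -> i \in c.2 /\ c.1 i = 0%N) ->
  (\sum_(x <- slices w) in_cell (slice w c x) a)%N =
  (in_cell c a && ~~ (w <= a)%MM).
Proof.
move=> wc; rewrite big_allpairs_dep big_enum /=.
pose first (s : 'I_n) :=
  [forall i : 'I_n, (i < s)%N ==> (w i <= a i)%N] && (a s < w s)%N.
have -> : (\sum_s \sum_(t <- iota 0 (w s)) in_cell (slice w c (s, t)) a)%N =
    (\sum_s (in_cell c a && first s))%N.
  apply: eq_bigr => s _; have [w0|ws] := eqVneq (w s) 0%N.
    by rewrite w0 big_nil /first w0 !andbF.
  under eq_bigr do rewrite in_slice // andbA.
  rewrite /first andbA; set b := in_cell c a && _.
  case: b => /=; last by rewrite big1.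
  have -> : (a s < w s)%N = (a s \in iota 0 (w s)) by rewrite mem_iota.
  have count j k : (\sum_(t <- iota j k) (a s == t) = (a s \in iota j k))%N.
    elim: k j => [|k IH] j; first by rewrite big_nil.
    rewrite big_cons IH inE; case: eqP => [->|_] /=; last by rewrite add0n.
    by rewrite mem_iota ltnn.
  exact: count.
case: (in_cell c a) => /=; last by rewrite big1.
have [wa|wa] := boolP (w <= a)%MM.
  by rewrite big1 // => s _; rewrite /first ltnNge (mnm_lepP wa) andbF.
apply/sum_nat_eq1P.
have [i0 wi0] : exists i, (a i < w i)%N.
  by move: wa => /forallPn [i]; rewrite -ltnNge; exists i.
pose s := [arg min_(i < i0 | (a i < w i)%N) (i : nat)].
have [ws smin] : (a s < w s)%N /\ forall j, (a j < w j)%N -> (s <= j)%N.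
  by rewrite /s; case: arg_minnP.
exists s => [|j /andP [/forallP wj aj]].
  rewrite /first ws andbT; apply/forallP => i; apply/implyP.
  by apply: contraTT; rewrite -ltnNge -leqNgt => /smin.
apply/val_inj/eqP; rewrite /= eqn_leq smin // andbT leqNgt.
by apply/negP => ltsj; have := wj s; rewrite ltsj leqNgt ws.
Qed.

(** * The two bounds for the Stanley depth *)

Section DisjointSupports.
Variables (m : nat) (I : {pred S}) (v : m.-tuple 'X_{1..n}).
Hypotheses (m_gt0 : (0 < m)%N) (Iv : generated_by I v).
Hypothesis v_neq0 : forall k, tnth v k != 0%MM.
Hypothesis v_disj :
  forall k l i, tnth v k i != 0%N -> tnth v l i != 0%N -> k = l.

Lemma mem_disjoint a :
  'X_[a] \in I = [exists k, (tnth v k <= a)%MM].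
Proof.
rewrite (mem_generated _ Iv); apply/hasP/existsP => [[_ /tnthP [k ->]]|[k]].
  by exists k.
by exists (tnth v k); first exact: mem_tnth.
Qed.

Lemma disjoint_lep k l : (tnth v k <= tnth v l)%MM -> k = l.
Proof.
have [i vi] := exists_support (v_neq0 k).
by move=> /mnm_lepP /(_ i) le_kl; apply: (v_disj vi); move: vi le_kl; lia.
Qed.

(** A new generator contributes the cell of all its multiples and slices the old cells. The clause
    on variables outside the supports of [ks] is what allows the next slicing. *)
Lemma exists_cells (ks : seq 'I_m) : uniq ks -> exists L : seq cell,
  (forall a, (\sum_(c <- L) in_cell c a)%N = has (fun k => tnth v k <= a)%MM ks)
  /\ {in L, forall c, (n < #|c.2| + size ks)%N /\ forall i,
       {in ks, forall k, tnth v k i = 0%N} -> i \in c.2 /\ c.1 i = 0%N}.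
Proof.
elim: ks => [_|k ks IH /= /andP [kks /IH [L [LP Lc]]]].
  by exists [::]; split=> // a; rewrite big_nil.
have wc c i : c \in L -> tnth v k i != 0%N -> i \in c.2 /\ c.1 i = 0%N.
  move=> /Lc [_ cP] vk; apply: cP => l lks; apply/eqP.
  by apply: contraNT kks => /(v_disj vk) ->.
exists ((tnth v k, setT) :: [seq slice (tnth v k) c x | c <- L, x <- slices (tnth v k)]).
split=> [a|c].
  rewrite big_cons big_allpairs_dep /=.
  have -> : in_cell (tnth v k, setT) a = (tnth v k <= a)%MM.
    by apply: eq_forallb => i; rewrite inE.
  have -> : (\sum_(c <- L) \sum_(x <- slices (tnth v k))
      in_cell (slice (tnth v k) c x) a =
      \sum_(c <- L) in_cell c a * ~~ (tnth v k <= a)%MM)%N.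
    rewrite big_seq [RHS]big_seq; apply: eq_bigr => c cL.
    by rewrite sum_in_slices ?mulnb // => i; apply: wc.
  by rewrite -big_distrl /= LP; case: (tnth v k <= a)%MM; case: has.
rewrite inE => /orP [/eqP ->|/allpairsPdep [c' [[s t] [c'L xs ->]]]] /=.
  split=> [|i vi]; first by rewrite cardsT card_ord; lia.
  by rewrite inE vi ?mem_head.
have vs : tnth v k s != 0%N.
  by move: xs => /allpairsPdep [s' [t' [_]]]; rewrite mem_iota => ? [-> _]; lia.
have [[sZ us] [ltn cP]] := (wc _ _ c'L vs, Lc _ c'L); split.
  by move: ltn; rewrite (cardsD1 s c'.2) sZ add1n addSnnS.
move=> i vi; have vki : tnth v k i = 0%N by apply: vi; rewrite mem_head.
have ns : i != s by apply: contraNneq vs => <-; rewrite vki.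
have [|iZ ui] := cP i; first by move=> l lks; apply: vi; rewrite inE lks orbT.
by rewrite !inE ns iZ mnmE vki ui (negbTE ns) if_same.
Qed.

Lemma sdepth_ge : exists (r : nat) (D : 'I_r -> cell),
  stanley_decomposition I D /\ (n.+1 - m <= decomposition_sdepth D)%N.
Proof.
have [L [LP Lc]] := exists_cells (enum_uniq 'I_m).
exists (size L), (fun i => tnth (in_tuple L) i); split.
  apply/(stanley_decompositionP _ Iv) => a.
  rewrite -(big_tnth _ _ L predT (fun c => nat_of_bool (in_cell c a))) LP mem_disjoint.
  congr nat_of_bool; apply/hasP/existsP => [[k _]|[k]]; first by exists k.
  by exists k; rewrite ?mem_enum.
(* The default value [n] of the minimum satisfies the bound because [m] is positive. *)
apply: leq_bigminn => [|i]; first by move: m_gt0; lia.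
have [+ _] := Lc _ (mem_tnth i (in_tuple L)).
by rewrite size_enum_ord leq_subLR addnC.
Qed.

Lemma sdepth_le r (D : 'I_r -> cell) :
  stanley_decomposition I D ->
  (decomposition_sdepth D + m <= n + uphalf m)%N.
Proof.
move/(stanley_decompositionP _ Iv) => DI; set d := decomposition_sdepth D.
have dD i : (d <= #|(D i).2|)%N by apply: bigminn_le.
have Duniq a i j : in_cell (D i) a -> in_cell (D j) a -> i = j.
  move=> ia ja; have : (\sum_i in_cell (D i) a)%N = 1%N.
    by rewrite DI; move: (DI a); rewrite (bigD1 i) //= ia; case: (_ \in I).
  by case/sum_nat_eq1P => k _ ku; rewrite (ku j ja) (ku i ia).
have exi k : exists i, in_cell (D i) (tnth v k).
  have : (\sum_i in_cell (D i) (tnth v k))%N = 1%N.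
    rewrite DI mem_disjoint; apply/eqP; rewrite eqb1; apply/existsP.
    by exists k; apply: lepm_refl.
  by case/sum_nat_eq1P => i; exists i.
have [ix ixP] := fin_all_exists exi.
(* The base point of this cell divides [v_k] and lies in [I], so some [v_l] divides it; then [v_l]
   divides [v_k], which forces [l = k]. *)
have ixE k : (D (ix k)).1 = tnth v k.
  have lek : ((D (ix k)).1 <= tnth v k)%MM.
    apply/mnm_lepP => i; have /in_cellP /(_ i) := ixP k.
    by case: ifP => // _ /eqP ->.
  have : 'X_[(D (ix k)).1] \in I.
    have := DI (D (ix k)).1; rewrite (bigD1 (ix k)) //=.
    have -> : in_cell (D (ix k)) (D (ix k)).1.
      by apply/in_cellP => i; rewrite leqnn eqxx if_same.
    by case: (_ \in I).
  rewrite mem_disjoint => /existsP [l lel].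
  have lk := disjoint_lep (lepm_trans lel lek); rewrite lk in lel.
  apply/mnmP => i; apply/eqP.
  by rewrite eqn_leq (mnm_lepP lel) (mnm_lepP lek).
pose e k l := (k != l) && [forall i, (tnth v l i != 0%N) ==> (i \in (D (ix k)).2)].
have eP k l : e k l -> in_cell (D (ix k)) (tnth v k + tnth v l)%MM.
  move=> /andP [_ /forallP h]; apply/in_cellP => i; rewrite ixE mnmDE leq_addr.
  case: ifP => // iZ; have := h i; rewrite iZ implybF negbK => /eqP ->.
  by rewrite addn0.
have e_asym k l : (e k l + e l k <= (k != l))%N.
  have [->|kl] := eqVneq k l; first by rewrite /e eqxx.
  case ekl : (e k l); case elk : (e l k) => //.
  have := Duniq _ _ _ (eP _ _ ekl); rewrite addmC => /(_ _ (eP _ _ elk)) ixkl.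
  have : tnth v k = tnth v l by rewrite -!ixE ixkl.
  by move=> vkl; rewrite (disjoint_lep (k := k) (l := l)) ?eqxx ?vkl ?lepm_refl in kl.
have out k : (m + d <= n.+1 + \sum_l e k l)%N.
  pose A := [set l | [exists i, (i \notin (D (ix k)).2) && (tnth v l i != 0%N)]].
  (* A variable lies in at most one support, so sending variables to their generators maps the
     complement of the free set onto a superset of [A]. *)
  have cA : (#|A| <= #|~: (D (ix k)).2|)%N.
    pose h i := odflt k [pick l | tnth v l i != 0%N].
    apply: leq_trans (leq_imset_card h _); apply/subset_leq_card/subsetP => l.
    rewrite inE => /existsP [i /andP [iZ vli]]; apply/imsetP; exists i.
      by rewrite inE.
    rewrite /h; case: pickP => [l' vl'|/(_ l)] /=; last by rewrite vli.
    exact: v_disj vli vl'.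
  have : (\sum_(l < m) 1 <= \sum_l ((l == k) + (l \in A) + e k l))%N.
    apply: leq_sum => l _; rewrite /e eq_sym.
    case: eqP => //= _; rewrite inE; case: existsP => //= nA.
    rewrite lt0b; apply/forallP => i; apply/implyP => vli.
    by apply: contraT => iZ; case: nA; exists i; rewrite iZ.
  rewrite sum1_card card_ord !big_split /=.
  have -> : (\sum_l (l == k) = 1)%N by apply/sum_nat_eq1P; exists k => // j /eqP.
  have -> : (\sum_l (l \in A) = #|A|)%N by rewrite -sum1_card [RHS]big_mkcond.
  have := cardsC (D (ix k)).2; rewrite card_ord; have := dD (ix k); lia.
(* By asymmetry each ordered pair of distinct indices contributes at most one to the doubled sum. *)
have tot : (2 * (\sum_k \sum_l e k l) <= m * m.-1)%N.
  rewrite mul2n -addnn [X in (_ + X <= _)%N]exchange_big -big_split /=.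
  under eq_bigr do rewrite -big_split /=.
  have -> : (m * m.-1 = \sum_(k < m) m.-1)%N.
    by rewrite sum_nat_const card_ord.
  apply: leq_sum => k _.
  have -> : (m.-1 = \sum_(l < m) (k != l))%N.
    have : (\sum_(l < m) ((k == l) + (k != l)) = m)%N.
      rewrite -[RHS]card_ord -sum1_card; apply: eq_bigr => l _; by case: eqP.
    rewrite big_split /=.
    have -> : (\sum_l (k == l) = 1)%N.
      by apply/sum_nat_eq1P; exists k => // j /eqP.
    lia.
  exact: leq_sum.
have sumout : (m * (m + d) <= m * n.+1 + \sum_k \sum_l e k l)%N.
  have -> : (m * (m + d) = \sum_(k < m) (m + d))%N by rewrite sum_nat_const card_ord.
  have -> : (m * n.+1 = \sum_(k < m) n.+1)%N by rewrite sum_nat_const card_ord.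
  by rewrite -big_split /=; apply: leq_sum.
(* Summation over [k] is undone by cancelling [m]; halving then rounds [(m + 1) / 2] down to
   [uphalf m]. *)
have : (2 * (m + d) <= 2 * n.+1 + m.-1)%N.
  rewrite -(leq_pmul2l m_gt0); lia.
by rewrite uphalfE; lia.
Qed.

End DisjointSupports.
End Stanley.

(** * Existence of the maxima, and the conclusion *)

Lemma exists_max (P : nat -> Prop) b :
  (exists d, P d) -> (forall d, P d -> (d <= b)%N) -> exists d, is_max P d.
Proof.
move=> exP; elim: b => [|b IH] Pb.
  by case: exP => d Pd; exists d; split=> // e /Pb; move: (Pb d Pd); lia.
(* [P] need not be decidable; excluded middle either attains the bound or lowers it. *)
have [PSb|nPSb] := classic (P b.+1); first by exists b.+1.
apply: IH => d Pd; have := Pb d Pd; rewrite leq_eqVlt => /orP [/eqP dE|//].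
by rewrite dE in Pd.
Qed.

Theorem theorem2p4 (K : fieldType) (n m : nat) (I : {pred {mpoly K[n]}})
    (v : m.-tuple 'X_{1..n}) (hI : monomial_complete_intersection I v) :
  exists s : nat,
    [/\ is_sdepth I s,
        1 + n%:Z - m%:Z <= s%:Z,
        s%:Z <= (uphalf m)%:Z + n%:Z - m%:Z
      & exists2 d : nat, is_depth I d & (d <= s)%N].
Proof.
have m_gt0 := complete_intersection_gt0 hI.
have v_neq0 k := complete_intersection_neq0 k hI.
have v_disj k l i := @complete_intersection_disjoint _ _ _ _ _ k l i hI.
have [[p0 Ip0 p0_neq0] _ [Iv _] _] := hI.
have [r [D [DI le_D]]] := sdepth_ge m_gt0 Iv v_disj.
have [s [sP smax]] : exists s, is_sdepth I s.
  apply: (@exists_max _ (n + uphalf m)); first by exists (decomposition_sdepth D), r, D.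
  move=> _ [r' [D' [/(sdepth_le m_gt0 Iv v_neq0 v_disj) + <-]]].
  exact: leq_trans (leq_addr _ _).
have le_s : (n.+1 - m <= s)%N.
  by apply: leq_trans le_D _; apply: smax; exists r, D.
have s_le : (s + m <= n + uphalf m)%N.
  case: sP => r' [D' [/(sdepth_le m_gt0 Iv v_neq0 v_disj) + <-]]; exact.
have depth_bound fs : regular_sequence I fs ->
    {in fs, forall f, irrelevant_ideal f} -> (size fs + m <= n.+1)%N.
  exact: depth_le.
have [d [dP dmax]] : exists d, is_depth I d.
  apply: (@exists_max _ n.+1).
    (* The empty sequence is regular on [I] because [I] contains the nonzero [p0]. *)
    exists 0%N, [::]; split=> //; split=> //.
    by exists p0 => // /mul_ideal_nil /eqP; rewrite (negbTE p0_neq0).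
  move=> _ [fs [<- fsx reg]]; apply: leq_trans (depth_bound fs reg fsx).
  exact: leq_addr.
exists s; split=> //; [lia | lia | exists d => //].
(* Depth and Stanley depth are compared through [n.+1 - m]. *)
have [fs [<- fsx reg]] := dP; have := depth_bound fs reg fsx.
by move/(leq_sub2r m); rewrite addnK => /leq_trans; apply.
Qed.
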